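(* Let $\mathcal{H}$ be a separable infinite-dimensional Hilbert space with an orthonormal basis $\{e_j\}_{j\in\mathbb{N}}$, and let $B(\mathcal{H})$ be the space of all bounded linear operators on $\mathcal{H}$ with the operator norm. Let $K$ be a two-sided ideal cone in $B(\mathcal{H})$. If there exists a sequence $\{J_n\}_{n\in\mathbb{N}}$ of mutually disjoint subsets of $\mathbb{N}$ such that $P_{J_n}KP_{J_n}\neq P_{J_n}B(\mathcal{H})P_{J_n}$ for all $n\in\mathbb{N}$, then $B(\mathcal{H})\setminus K$ is spaceable in $B(\mathcal{H})$.
   Context: For $J\subseteq\mathbb{N}$, $P_J$ denotes the orthogonal projection of $\mathcal{H}$ onto $\overline{\mathrm{span}}\{e_j\}_{j\in J}$ (with $P_\varnothing=0$). For a set $L\subseteq B(\mathcal{H})$, $P_JLP_J:=\{P_JTP_J:\ T\in L\}$. A subset $K$ of a vector space is called a cone if $cK\subseteq K$ for each scalar $c$. A two-sided ideal cone in $B(\mathcal{H})$ is a cone $K\subseteq B(\mathcal{H})$ such that $ST\in K$ and $TS\in K$ for all $T\in K$ and $S\in B(\mathcal{H})$. A subset $S$ of a Banach space $Y$ is called spaceable in $Y$ if $S\cup\{0\}$ contains a closed infinite-dimensional linear subspace of $Y$. *)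

(* Defs.v *)
From HB Require Import structures.
From mathcomp Require Import all_boot all_order all_algebra.
From mathcomp Require Import all_classical all_reals all_analysis.
From mathcomp Require Import complex ring.

Set Implicit Arguments.
Unset Strict Implicit.
Unset Printing Implicit Defensive.

Import Order.TTheory GRing.Theory Num.Theory numFieldNormedType.Exports.

Local Open Scope classical_set_scope.
Local Open Scope ring_scope.

(* The scalar field of a Hilbert space, i.e. the reals or the complex numbers,
   treated uniformly. Up to isomorphism these are the only two models
   (see [scalar_real_or_complex]). *)
HB.mixin Record isScalarField (R : realType) K & Num.NumField K := {
  ofReal : {rmorphism R -> K} ;
  scalar_conj : {rmorphism K -> K} ;
  le_ofReal : {mono ofReal : x y / x <= y} ;
  norm_ofReal : forall z : K, exists r : R, `|z| = ofReal r ;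
  mul_scalar_conj : forall z : K, z * scalar_conj z = `|z| ^+ 2
}.

#[short(type="scalarFieldType")]
HB.structure Definition ScalarField (R : realType) :=
  {K of Num.NumField K & isScalarField R K}.

Section scalar_instances.
Variable R : realType.

Let real_le : {mono (idfun : R -> R) : x y / x <= y}. Proof. by []. Qed.

Let real_norm (z : R) : exists r : R, `|z| = idfun r. Proof. by exists `|z|. Qed.

Let real_mul_conj (z : R) : z * idfun z = `|z| ^+ 2.
Proof. by rewrite real_normK ?num_real// expr2. Qed.

HB.instance Definition _ := @isScalarField.Build R (Real.sort R)
  (idfun : {rmorphism R -> R}) (idfun : {rmorphism R -> R})
  real_le real_norm real_mul_conj.

Let complex_le : {mono (real_complex R : R -> R[i]) : x y / x <= y}.
Proof. by move=> x y; rewrite lecR. Qed.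

Let complex_norm (z : R[i]) : exists r : R, `|z| = real_complex R r.
Proof. by exists (Num.sqrt (complex.Re z ^+ 2 + complex.Im z ^+ 2)); rewrite normc_def. Qed.

Let complex_mul_conj (z : R[i]) : z * conjc z = `|z| ^+ 2.
Proof. by rewrite sqr_normc. Qed.

HB.instance Definition _ := @isScalarField.Build R R[i]
  (real_complex R : {rmorphism R -> R[i]}) (@conjc R : {rmorphism R[i] -> R[i]})
  complex_le complex_norm complex_mul_conj.

End scalar_instances.

Lemma scalar_real_or_complex (R : realType) (F : scalarFieldType R) :
  (forall z : F, exists a : R, z = ofReal a) \/
  (exists2 i : F, i ^+ 2 = -1 &
     forall z : F, exists a b : R, z = ofReal a + ofReal b * i).
Proof.
have scK (z : F) : scalar_conj (scalar_conj z) = z.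
  have [->|z0] := eqVneq z 0; first by rewrite !rmorph0.
  have cr (a : R) : scalar_conj (ofReal a : F) = ofReal a.
    have [->|a0] := eqVneq a 0; first by rewrite !rmorph0.
    have ra0 : (ofReal a : F) != 0 by rewrite fmorph_eq0.
    apply: (mulfI ra0); rewrite mul_scalar_conj.
    have [a_ge0|/ltW a_le0] := leP 0 a.
      by rewrite ger0_norm ?expr2// -(rmorph0 (ofReal : {rmorphism R -> F})) le_ofReal.
    rewrite ler0_norm ?sqrrN ?expr2//.
    by rewrite -(rmorph0 (ofReal : {rmorphism R -> F})) le_ofReal.
  have cz0 : scalar_conj z != 0 by rewrite fmorph_eq0.
  apply: (mulfI cz0); rewrite -rmorphM [RHS]mulrC !mul_scalar_conj.
  by have [r ->] := norm_ofReal z; rewrite rmorphXn /= cr.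
have realE (z : F) : scalar_conj z = z -> exists a : R, z = ofReal a.
  move=> zE; have [r rE] := norm_ofReal z.
  have : z ^+ 2 == ofReal r ^+ 2 by rewrite expr2 -{2}zE mul_scalar_conj rE.
  rewrite eqf_sqr => /orP[] /eqP ->; first by exists r.
  by exists (- r); rewrite rmorphN.
have [allreal|] := pselect (forall z : F, scalar_conj z = z).
  by left=> z; exact: realE.
move=> /existsNP[z /eqP zN]; right.
set w := z - scalar_conj z.
have w0 : w != 0 by rewrite subr_eq0 eq_sym.
have cw : scalar_conj w = - w by rewrite /w rmorphB /= scK opprB.
have [r rE] := norm_ofReal w.
have r0 : (ofReal r : F) != 0 by rewrite -rE normr_eq0.
have w2 : w ^+ 2 = - ofReal r ^+ 2.
  by rewrite -rE -mul_scalar_conj cw mulrN opprK expr2.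
exists (w / ofReal r).
  by rewrite expr_div_n w2 mulNr divff// expf_neq0.
move=> u.
have two0 : (2 : F) != 0 by rewrite pnatr_eq0.
have [a aE] : exists a : R, (u + scalar_conj u) / 2 = ofReal a.
  by apply: realE; rewrite rmorphM fmorphV rmorphD /= scK rmorph_nat addrC.
have [b bE] : exists b : R, (u - scalar_conj u) / w * (ofReal r / 2) = ofReal b.
  have [s sE] : exists s : R, (u - scalar_conj u) / w = ofReal s.
    apply: realE; rewrite rmorphM fmorphV rmorphB /= scK cw invrN mulrN -mulNr.
    by rewrite opprB.
  by exists (s * (r / 2)); rewrite rmorphM sE fmorph_div rmorph_nat.
exists a, b; rewrite -aE -bE.
by field; rewrite w0 r0.
Qed.

(* [inner] is linear in its first argument, conjugate-linear in the second. *)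
HB.mixin Record isHilbert (R : realType) (F : scalarFieldType R) H
    & CompleteNormedModule F H := {
  inner : {dot H for (@scalar_conj R F : F -> F)} ;
  inner_norm : forall x : H, inner x x = `|x| ^+ 2
}.

#[short(type="hilbertType")]
HB.structure Definition Hilbert (R : realType) (F : scalarFieldType R) :=
  {H of CompleteNormedModule F H & isHilbert R F H}.

Section spaceability.
Variable F : numFieldType.

Definition linear_span (V : lmodType F) (A : set V) : set V :=
  [set x | exists (n : nat) (c : 'I_n -> F) (v : 'I_n -> V),
     (forall i, A (v i)) /\ x = \sum_i c i *: v i].

Definition finite_dimensional (V : lmodType F) (L : set V) :=
  exists2 A : set V, finite_set A & L = linear_span A.

Definition spaceable (Y : completeNormedModType F) (S : set Y) :=
  exists L : set Y, [/\ submod_closed [in L], closed L,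
    ~ finite_dimensional L & L `<=` S `|` [set 0]].

End spaceability.

Section bounded_operators.
Variables (R : realType) (F : scalarFieldType R) (V : normedModType F).

Definition bounded_linear (T : V -> V) :=
  linear T /\ exists M : F, forall x, `|T x| <= M * `|x|.

Definition bounded_linear_pred : {pred V -> V} := fun T => `[< bounded_linear T >].

Record bop := Bop { bop_fun :> V -> V ; _ : bop_fun \in bounded_linear_pred }.

HB.instance Definition _ := [isSub for bop_fun].
HB.instance Definition _ := [Choice of bop by <:].

Lemma bopP (T : bop) : bounded_linear T.
Proof. by apply/asboolP; exact: (valP T). Qed.

Lemma bopD (T : bop) (x y : V) : T (x + y) = T x + T y.
Proof. by have [+ _] := bopP T; move=> /(_ 1 x y); rewrite !scale1r. Qed.

Lemma bop0 (T : bop) : T 0 = 0.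
Proof. by apply: (addrI (T 0)); rewrite -bopD !addr0. Qed.

Lemma bopZ (T : bop) (a : F) (x : V) : T (a *: x) = a *: T x.
Proof. by have [+ _] := bopP T; move=> /(_ a x 0); rewrite bop0 !addr0. Qed.

Lemma bop_bounded (T : bop) :
  exists2 M : F, 0 <= M & forall x, `|T x| <= M * `|x|.
Proof.
have [_ [M TM]] := bopP T; exists `|M|; first exact: normr_ge0.
move=> x; apply: (le_trans (TM x)).
have [->|x0] := eqVneq x 0; first by rewrite normr0 !mulr0.
have xgt0 : 0 < `|x| by rewrite normr_gt0.
have M0 : 0 <= M by rewrite -(pmulr_lge0 _ xgt0) (le_trans _ (TM x)).
by rewrite (ger0_norm M0).
Qed.

Lemma bounded_linear_submod_closed : submod_closed bounded_linear_pred.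
Proof.
split.
  apply/asboolP; split; first by move=> a x y; rewrite /= scaler0 addr0.
  by exists 0 => x; rewrite mul0r normr0.
move=> a S T Sb Tb; apply/asboolP.
have -> : S = Bop Sb by []. have -> : T = Bop Tb by [].
move: (Bop Sb) (Bop Tb) => {Sb Tb} {}S {}T.
split=> [b x y|].
  rewrite -![(_ + _ : V -> V) _]/(_ + _) -![(a *: (S : V -> V)) _]/(a *: S _).
  rewrite !bopD !bopZ !scalerDr !scalerA addrACA; congr (_ + _ + _).
  by rewrite mulrC.
have [M M0 SM] := bop_bounded S; have [N N0 TN] := bop_bounded T.
exists (`|a| * M + N) => x; rewrite mulrDl -mulrA.
apply: (le_trans (ler_normD _ _)); apply: lerD => //.
by rewrite normrZ ler_wpM2l.
Qed.

HB.instance Definition _ :=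
  GRing.isSubmodClosed.Build _ _ bounded_linear_pred bounded_linear_submod_closed.
HB.instance Definition _ := [SubChoice_isSubLmodule of bop by <:].

Lemma bop_eqP (S T : bop) : S =1 T -> S = T.
Proof. by move=> ST; exact/val_inj/funext. Qed.

Definition bop_one_subproof : idfun \in bounded_linear_pred.
Proof. by apply/asboolP; split=> //; exists 1 => x; rewrite mul1r. Qed.

Definition bop_comp_subproof (S T : bop) : S \o T \in bounded_linear_pred.
Proof.
apply/asboolP; split=> [a x y|]; first by rewrite /= bopD bopZ bopD bopZ.
have [M M0 SM] := bop_bounded S; have [N N0 TN] := bop_bounded T.
by exists (M * N) => x /=; rewrite (le_trans (SM _))// -mulrA ler_wpM2l.
Qed.

Definition bop_one := Bop bop_one_subproof.
Definition bop_comp (S T : bop) := Bop (bop_comp_subproof S T).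

Let bop_mulA : associative bop_comp. Proof. by move=> S T U; exact: bop_eqP. Qed.
Let bop_mul1l : left_id bop_one bop_comp. Proof. by move=> S; exact: bop_eqP. Qed.
Let bop_mul1r : right_id bop_one bop_comp. Proof. by move=> S; exact: bop_eqP. Qed.
Let bop_mulDl : left_distributive bop_comp +%R.
Proof. by move=> S T U; exact: bop_eqP. Qed.
Let bop_mulDr : right_distributive bop_comp +%R.
Proof. by move=> S T U; apply: bop_eqP => x; exact: bopD. Qed.

(* The product [S * T] of operators is their composition. *)
HB.instance Definition _ := GRing.Zmodule_isPzRing.Build bop
  bop_mulA bop_mul1l bop_mul1r bop_mulDl bop_mulDr.

(* Norms take values in F, suprema exist in R: the supremum is taken in R and
   sent back to F. *)
Definition opnorm (T : bop) : F :=
  ofReal (sup [set r : R | exists2 x : V, `|x| <= 1 & ofReal r = `|T x|]).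

Let ofReal0 : (ofReal 0 : F) = 0. Proof. exact: rmorph0. Qed.

Let opset (T : bop) := [set r : R | exists2 x : V, `|x| <= 1 & ofReal r = `|T x|].

Let opset_has_sup (T : bop) : has_sup (opset T).
Proof.
split; first by exists 0; exists 0; rewrite ?normr0// bop0 normr0 ofReal0.
have [M M0 TM] := bop_bounded T; have [m mE] := norm_ofReal M.
exists m => r [x x1 rE]; rewrite -(@le_ofReal _ F) rE -mE (ger0_norm M0).
by rewrite (le_trans (TM x))// ler_piMr.
Qed.

Lemma ler_opnorm (T : bop) (x : V) : `|T x| <= opnorm T * `|x|.
Proof.
have [->|x0] := eqVneq x 0; first by rewrite bop0 !normr0 mulr0.
have xgt0 : 0 < `|x| by rewrite normr_gt0.
rewrite -ler_pdivrMr//.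
have yE : `|T (`|x|^-1 *: x)| = `|T x| / `|x|.
  by rewrite bopZ normrZ normfV normr_id mulrC.
have [r rE] := norm_ofReal `|T (`|x|^-1 *: x)|.
rewrite normr_id in rE.
rewrite -yE rE le_ofReal; apply: sup_ubound; first by case: (opset_has_sup T).
by exists (`|x|^-1 *: x); rewrite ?rE// normrZ normfV normr_id mulVf ?gt_eqF.
Qed.

Lemma opnorm_le (T : bop) (M : F) :
  0 <= M -> (forall x, `|T x| <= M * `|x|) -> opnorm T <= M.
Proof.
move=> M0 TM; have [m mE] := norm_ofReal M; rewrite (ger0_norm M0) in mE.
rewrite mE le_ofReal; apply: ge_sup; first by case: (opset_has_sup T).
move=> r [x x1 rE]; rewrite -(@le_ofReal _ F) rE -mE.
by rewrite (le_trans (TM x))// ler_piMr.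
Qed.

Lemma opnorm_ge0 (T : bop) : 0 <= opnorm T.
Proof.
rewrite -ofReal0 le_ofReal; apply: sup_ubound; first by case: (opset_has_sup T).
by exists 0; rewrite ?normr0// bop0 normr0 ofReal0.
Qed.

Let opnormD (S T : bop) : opnorm (S + T) <= opnorm S + opnorm T.
Proof.
apply: opnorm_le; first by rewrite addr_ge0 ?opnorm_ge0.
move=> x; rewrite mulrDl (le_trans (ler_normD _ _))//.
by rewrite lerD ?ler_opnorm.
Qed.

Let opnormZ_le (a : F) (T : bop) : opnorm (a *: T) <= `|a| * opnorm T.
Proof.
apply: opnorm_le; first by rewrite mulr_ge0 ?opnorm_ge0.
by move=> x; rewrite [X in X <= _]normrZ -mulrA ler_wpM2l// ler_opnorm.
Qed.

Let opnormZ (a : F) (T : bop) : opnorm (a *: T) = `|a| * opnorm T.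
Proof.
apply/eqP; rewrite eq_le opnormZ_le /=.
have [->|a0] := eqVneq a 0; first by rewrite normr0 mul0r opnorm_ge0.
have := opnormZ_le a^-1 (a *: T); rewrite scalerA mulVf// scale1r normfV.
by rewrite ler_pdivlMl// normr_gt0.
Qed.

Let opnorm_eq0 (T : bop) : opnorm T = 0 -> T = 0.
Proof.
move=> T0; apply: bop_eqP => x; apply/eqP; rewrite -normr_le0.
by rewrite (le_trans (ler_opnorm T x))// T0 mul0r.
Qed.

HB.instance Definition _ :=
  Lmodule_isNormed.Build F bop opnormD opnormZ opnorm_eq0.

End bounded_operators.

Section bounded_operators_complete.
Variables (R : realType) (F : scalarFieldType R) (V : completeNormedModType F).

Lemma bop_complete (G : set_system (bop V)) :
  ProperFilter G -> cauchy G -> cvg G.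
Proof.
move=> PG /cauchy_ballP Gc.
have {}Gc (e : F) : 0 < e -> exists A : set (bop V),
    G A /\ forall S T, A S -> A T -> forall x, `|S x - T x| <= e * `|x|.
  move=> e0; have [[A B] /= [GA GB] AB] := Gc e e0.
  exists (A `&` B); split; first exact: filterI.
  move=> S T [AS _] [_ BT] x.
  have := AB (S, T) (conj AS BT); rewrite -ball_normE /= => /ltW ST.
  apply: (le_trans (ler_opnorm (S - T) x)).
  exact: ler_wpM2r.
have evc (x : V) : cvg ((fun T : bop V => T x) @ G).
  apply: cauchy_cvg; apply/cauchy_ballP => e e0.
  have x0 : 0 < `|x| + 1 by rewrite ltr_wpDl.
  have [A [GA Ax]] := Gc _ (divr_gt0 e0 x0).
  exists ((fun T : bop V => T x) @` A, (fun T : bop V => T x) @` A) => /=.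
    by split; apply: (@filterS _ G _ A _ _ GA) => T AT; exists T.
  move=> [_ _] /= [[S AS <-] [T AT <-]]; rewrite -ball_normE /=.
  apply: (le_lt_trans (Ax _ _ AS AT x)).
  by rewrite mulrAC ltr_pdivrMr// ltr_pM2l// ltrDl.
pose g x := lim ((fun T : bop V => T x) @ G).
have glin : linear g.
  move=> a x y; apply: (cvg_lim (@norm_hausdorff _ V)).
  under eq_fun do rewrite bopD bopZ.
  by apply: cvgD; [apply: cvgZr; exact: evc|exact: evc].
have gdist (e : F) (A : set (bop V)) : 0 < e -> G A ->
    (forall S T, A S -> A T -> forall x, `|S x - T x| <= e * `|x|) ->
    forall S x, A S -> `|g x - S x| <= (e + e) * `|x|.
  move=> e0 GA Ae S x AS.
  have [->|x0] := eqVneq x 0.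
    have -> : g 0 = 0.
      apply: (cvg_lim (@norm_hausdorff _ V)).
      by under eq_fun do rewrite bop0; exact: cvg_cst.
    by rewrite bop0 subrr !normr0 mulr0.
  have d0 : 0 < e * `|x| by rewrite mulr_gt0// normr_gt0.
  have := evc x; move=> /cvgrPdist_lt /(_ _ d0) gx.
  have [T [AT Tx]] := filter_ex (filterI GA gx).
  rewrite (@le_trans _ _ (`|g x - T x| + `|T x - S x|)) ?ler_distD//.
  by rewrite mulrDl lerD//; [exact: ltW|exact: Ae].
have gP : g \in @bounded_linear_pred R F V.
  apply/asboolP; split=> //.
  have [A [GA A1]] := Gc 1 ltr01; have [S AS] := filter_ex GA.
  have [M M0 SM] := bop_bounded S.
  exists (1 + 1 + M) => x; rewrite -(subrK (S x) (g x)) mulrDl.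
  by rewrite (le_trans (ler_normD _ _))// lerD//; exact: (gdist 1 A ltr01 GA A1 S x AS).
apply/cvg_ex; exists (Bop gP); apply/cvgrPdist_le => e e0.
have e20 : 0 < e / 2 by rewrite divr_gt0.
have [A [GA Ae]] := Gc _ e20.
apply: (@filterS _ G _ A _ _ GA) => T AT.
apply: opnorm_le; first exact: ltW.
move=> x; rewrite [X in _ <= X * _]splitr; exact: (gdist (e / 2) A e20 GA Ae T x AT).
Qed.

HB.instance Definition _ := Uniform_isComplete.Build (bop V) bop_complete.

End bounded_operators_complete.

Section ideal_cones.
Variables (R : realType) (F : scalarFieldType R).

Definition cone (V : lmodType F) (K : set V) :=
  forall (c : F) (x : V), K x -> K (c *: x).

Definition two_sided_ideal_cone (V : normedModType F) (K : set (bop V)) :=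
  cone K /\ forall T S : bop V, K T -> K (S * T) /\ K (T * S).

End ideal_cones.

Section orthonormal_bases.
Variables (R : realType) (F : scalarFieldType R) (H : hilbertType F).

Definition orthonormal_basis (e : nat -> H) :=
  (forall i j, inner (e i) (e j) = (i == j)%:R) /\
  closure (linear_span (range e)) = setT.

(* The orthogonal projection onto M, which exists and is unique when M is a
   closed linear subspace. *)
Definition is_orthogonal_projection (M : set H) (P : bop H) :=
  forall x, M (P x) /\ forall y, M y -> inner (x - P x) y = 0.

Definition orthogonal_projection (M : set H) : bop H :=
  xget 0 [set P | is_orthogonal_projection M P].

Definition basis_projection (e : nat -> H) (J : set nat) : bop H :=
  orthogonal_projection (closure (linear_span (e @` J))).

Definition compression (e : nat -> H) (J : set nat) (L : set (bop H)) : set (bop H) :=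
  [set basis_projection e J * T * basis_projection e J | T in L].

End orthonormal_bases.

(* Main.v *)
(* Write P_n for the projection attached to J_n. Since K is an ideal cone, P_n
   is not in K: otherwise P_n T P_n = P_n (P_n T) P_n would show that the two
   compressions coincide. Take for L the closed space of all operators that are
   diagonal in the basis, act as a scalar a_n on the e_j with j in J_n, and
   vanish on the remaining e_j. A nonzero T in L has some a_n <> 0, and then
   P_n = a_n^-1 P_n T, so T is not in K. The P_n lie in L and are linearly
   independent as soon as no J_n is empty, which holds if K is nonempty (0 is
   then in K); if K is empty, the singletons {n} are used instead of the J_n. *)
Require Import Defs.
From HB Require Import structures.
From mathcomp Require Import all_boot all_order all_algebra.
From mathcomp Require Import all_classical all_reals all_analysis.

Import Order.TTheory GRing.Theory Num.Theory.
Import numFieldNormedType.Exports.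

Local Open Scope classical_set_scope.
Local Open Scope ring_scope.

(** * Spans, infinite dimension and closed kernels *)

Lemma linear_span_sub (F : numFieldType) (V : lmodType F) (A B : set V) :
  B 0 -> (forall a x y, B x -> B y -> B (a *: x + y)) ->
  A `<=` B -> linear_span A `<=` B.
Proof.
move=> B0 BP AB _ [n [c [v [Av ->]]]].
apply: (big_ind B) => // [x y Bx By|i _]; first by rewrite -(scale1r x); exact: BP.
by rewrite -[_ *: _]addr0; apply: BP => //; exact: AB.
Qed.

Lemma linear_span_mem (F : numFieldType) (V : lmodType F) (A : set V) :
  A `<=` linear_span A.
Proof.
move=> x Ax; exists 1, (fun=> 1), (fun=> x); split=> //.
by rewrite big_ord1 scale1r.
Qed.

Lemma linear_span_seq (F : numFieldType) (V : lmodType F) (s : seq V) (x : V) :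
  linear_span [set` s] x ->
  exists c : 'I_(size s) -> F, x = \sum_k c k *: s`_k.
Proof.
move: x; apply: linear_span_sub => [|a _ _ [c ->] [d ->]|x /= xs].
- by exists (fun=> 0); rewrite big1// => i _; rewrite scale0r.
- exists (fun k => a * c k + d k); rewrite scaler_sumr -big_split/=.
  by apply: eq_bigr => i _; rewrite scalerA scalerDl.
- have sx : (index x s < size s)%N by rewrite index_mem.
  exists (fun k => (k == Ordinal sx)%:R); rewrite (bigD1 (Ordinal sx))//= big1.
    by rewrite eqxx scale1r addr0 nth_index.
  by move=> i /negbTE ->; rewrite scale0r.
Qed.

(** If [s] spans [L], the coordinates of the first [(size s).+1] vectors [u i] form a matrix with
    more rows than columns. A nonzero row vector in its left kernel is a nontrivial relation among
    the [u i]. *)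
Lemma not_finite_dimensional (F : numFieldType) (V : lmodType F) (L : set V)
    (u : nat -> V) :
  (forall n, L (u n)) ->
  (forall n (c : 'I_n -> F), \sum_i c i *: u i = 0 -> forall i, c i = 0) ->
  ~ finite_dimensional L.
Proof.
move=> Lu freeu [A /finite_seqP[s ->] LE].
have /choice[c cE] : forall n, exists c : 'I_(size s) -> F,
    u n = \sum_k c k *: s`_k.
  by move=> n; apply: linear_span_seq; rewrite -LE.
pose M := \matrix_(i < (size s).+1, k < size s) c i k.
have : kermx M != 0.
  rewrite kermx_eq0 /row_free neq_ltn.
  by rewrite (leq_ltn_trans (rank_leq_col M)).
case/rowV0Pn => v /sub_kermxP vM /negP; apply; apply/eqP/rowP => i.
rewrite mxE; apply: (freeu _ (fun i => v 0 i)).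
under eq_bigr do rewrite cE scaler_sumr.
rewrite exchange_big/= big1// => k _.
under eq_bigr do rewrite scalerA.
rewrite -scaler_suml; have /rowP/(_ k) := vM; rewrite !mxE => vMk.
rewrite [X in X *: _](_ : _ = 0) ?scale0r//.
by rewrite -[RHS]vMk; apply: eq_bigr => j _; rewrite mxE.
Qed.

Lemma closed_kernel (F : numFieldType) (V : normedModType F)
    (W : normedZmodType F) (f : V -> W) (C : F) :
  0 <= C -> (forall x y, f (x - y) = f x - f y) ->
  (forall x, `|f x| <= C * `|x|) -> closed [set x | f x = 0].
Proof.
move=> C0 fB fC x clx; apply: contrapT => /eqP fx0.
have C1 : 0 < C + 1 by rewrite ltr_wpDl.
(* The ball of this radius around [x] misses the kernel; [C + 1] keeps the radius positive even when
   [C = 0]. *)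
have e0 : 0 < `|f x| / (C + 1) by rewrite divr_gt0 ?normr_gt0.
have [a [/= fa xa]] := clx _ (nbhsx_ballx x _ e0).
move: xa; rewrite -ball_normE /= ltr_pdivlMr// => xa.
have fxE : f x = f (x - a) by rewrite fB fa subr0.
have /lt_le_trans/(_ (fC _)) : `|x - a| * (C + 1) < `|f (x - a)| by rewrite -fxE.
rewrite mulrC => /lt_geF; rewrite ler_wpM2r// lerDl//.
Qed.

(** * Geometry of the inner product *)

Section inner_product.
Context {R : realType} {F : scalarFieldType R} {H : hilbertType F}.
Implicit Types x y z : H.

Lemma inner_eq0 x : inner x x = 0 -> x = 0.
Proof. by rewrite inner_norm => /eqP; rewrite expf_eq0/= normr_eq0 => /eqP. Qed.

Lemma inner_eq0_sym x y : inner x y = 0 -> inner y x = 0.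
Proof.
move=> xy; rewrite (_ : inner y x = (-1) ^+ false * scalar_conj (inner x y)).
  by rewrite xy rmorph0 mulr0.
exact: hermitian_subproof. Qed.

Lemma pythagoras x y : inner x y = 0 -> `|x + y| ^+ 2 = `|x| ^+ 2 + `|y| ^+ 2.
Proof.
move=> xy; rewrite -!inner_norm linearDl !linearDr/= xy (inner_eq0_sym _ _ xy).
by rewrite addr0 add0r.
Qed.

Lemma norm_le_of_orthogonal x y : inner x y = 0 -> `|y| <= `|x + y|.
Proof.
move=> xy; rewrite -(@ler_pXn2r _ 2) ?nnegrE// (pythagoras _ _ xy).
by rewrite lerDr exprn_ge0.
Qed.

Lemma cauchy_schwarz x y : `|inner x y| <= `|x| * `|y|.
Proof.
have [->|y0] := eqVneq y 0; first by rewrite linear0r !normr0 mulr0.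
have ny0 : `|y| != 0 by rewrite normr_eq0.
(* [c *: y] is the orthogonal projection of [x] onto the line of [y], so its norm
   [|inner x y| / |y|] is at most [|x|]. *)
pose c := inner x y / `|y| ^+ 2.
have xcy : inner (x - c *: y) (c *: y) = 0.
  rewrite linearZr_LR/= linearBl linearZl_LR/= inner_norm divfK ?subrr ?mulr0//.
  by rewrite expf_neq0.
have := norm_le_of_orthogonal _ _ xcy.
rewrite subrK normrZ normrM normfV normrX normr_id expr2 invfM.
by rewrite mulrA divfK// ler_pdivrMr// normr_gt0.
Qed.

Lemma closed_orthogonal_l y : closed [set x | inner x y = 0].
Proof.
apply: (@closed_kernel _ _ _ (fun x => inner x y) `|y|) => //.
- by move=> u v; rewrite linearBl.
- by move=> u; rewrite mulrC; exact: cauchy_schwarz.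
Qed.

Lemma closed_orthogonal_r x : closed [set y | inner x y = 0].
Proof.
apply: (@closed_kernel _ _ _ (fun y => inner x y) `|x|) => //.
- by move=> u v; rewrite linearBr.
- by move=> u; exact: cauchy_schwarz.
Qed.

(** The vectors orthogonal to [x] form a closed subspace containing [A]. *)
Lemma orthogonal_closure_span x (A : set H) :
  (forall a, A a -> inner x a = 0) ->
  forall y, closure (linear_span A) y -> inner x y = 0.
Proof.
move=> xA y; rewrite closureEbigcap => /(_ [set y | inner x y = 0]); apply; split; first exact: closed_orthogonal_r.
apply: linear_span_sub => // [|a u v]/=; first by rewrite linear0r.
by rewrite linearDr linearZr_LR/= => -> ->; rewrite mulr0 addr0.
Qed.

End inner_product.

(** * Operators and projections relative to an orthonormal basis *)

Lemma bopB (R : realType) (F : scalarFieldType R) (V : normedModType F)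
  (T : bop V) (x y : V) : T (x - y) = T x - T y.
Proof. by rewrite -(scaleN1r y) bopD bopZ scaleN1r. Qed.

Section orthonormal_system.
Context {R : realType} {F : scalarFieldType R} {H : hilbertType F}.
Variables (e : nat -> H) (he : orthonormal_basis e).
Implicit Types (x y z : H) (J : set nat).

Let ortho i j : inner (e i) (e j) = (i == j)%:R.
Proof. by case: he => + _; exact. Qed.

Lemma norm_basis i : `|e i| = 1.
Proof.
apply/eqP; rewrite -(@pexpr_eq1 _ _ 2)//; apply/eqP.
by rewrite -inner_norm ortho eqxx.
Qed.

(** The kernel of [S - T] is a closed subspace containing every [e j], and the [e j] span a dense
    subspace. *)
Lemma bop_eq_basis (S T : bop H) : (forall j, S (e j) = T (e j)) -> S = T.
Proof.
move=> ST; apply: bop_eqP => x.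
have : closure (linear_span (range e)) x by case: he => _ ->.
have [D DE] : exists D : bop H, forall y, D y = S y - T y by exists (S - T).
have [M M0 DM] := bop_bounded D.
move=> clx; apply/eqP; rewrite -subr_eq0 -DE; apply/eqP.
move: clx; rewrite closureEbigcap => /(_ [set x | D x = 0]); apply; split.
  apply: (@closed_kernel _ _ _ D M) => // u v; exact: bopB.
apply: linear_span_sub => [|a u v /= Du Dv|_ [j _ <-] /=]; first exact: bop0.
  by rewrite bopD bopZ Du Dv scaler0 addr0.
by rewrite DE ST subrr.
Qed.

(* The projection onto the closed span of the e_j with j in J is the pointwise
   limit of these partial Fourier sums: they are contractions (Bessel) and
   stationary on the dense span of the basis, so they converge everywhere. *)
Let psum J n x := \sum_(i < n | `[< J i >]) inner x (e i) *: e i.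

Let psumP J n a x y : psum J n (a *: x + y) = a *: psum J n x + psum J n y.
Proof.
rewrite /psum scaler_sumr -big_split/=; apply: eq_bigr => i _.
by rewrite linearDl linearZl_LR/= scalerDl scalerA.
Qed.

Let psumB J n x y : psum J n (x - y) = psum J n x - psum J n y.
Proof. by rewrite addrC -scaleN1r psumP scaleN1r addrC. Qed.

Let inner_psum J n x j : J j -> (j < n)%N -> inner (psum J n x) (e j) = inner x (e j).
Proof.
move=> Jj jn; rewrite linear_sumlz (bigD1 (Ordinal jn))/=; last exact/asboolP.
rewrite linearZl_LR/= ortho eqxx mulr1 big1 ?addr0// => i /andP[_ ij].
rewrite linearZl_LR/= ortho (_ : _ == _ = false) ?mulr0//.
by apply: contraNF ij => /eqP ij; exact/eqP/val_inj.
Qed.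

Let psum_residual J n x j : J j -> (j < n)%N -> inner (x - psum J n x) (e j) = 0.
Proof. by move=> Jj jn; rewrite linearBl/= inner_psum// subrr. Qed.

(** The residual [x - psum J n x] is orthogonal to each [e i] occurring in the partial sum, hence to
    the sum itself. *)
Let bessel J n x : `|psum J n x| <= `|x|.
Proof.
rewrite -[X in _ <= `|X|](subrK (psum J n x) x); apply: norm_le_of_orthogonal.
rewrite [X in inner _ X]/psum linear_sumr big1// => i /asboolP Ji.
by rewrite linearZr_LR/= psum_residual// mulr0.
Qed.

Let psum_stationary J y : linear_span (range e) y ->
  exists N, forall n, (N <= n)%N -> psum J n y = psum J N y.
Proof.
move: y; apply: linear_span_sub => [|a x y [N xN] [M yM]|_ [j _ <-]].
- exists 0%N => n _; rewrite /psum big_ord0 big1// => i _.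
  by rewrite linear0l scale0r.
- exists (maxn N M) => n; rewrite geq_max => /andP[Nn Mn].
  by rewrite !psumP xN// yM// (xN (maxn N M)) ?(yM (maxn N M)) ?leq_maxl ?leq_maxr.
- have psumE n : (j < n)%N -> psum J n (e j) = if `[< J j >] then e j else 0.
    move=> jn; rewrite /psum big_mkcond (bigD1 (Ordinal jn))//= ortho eqxx scale1r.
    rewrite big1 ?addr0// => i ij; case: ifP => // _; rewrite ortho.
    rewrite (_ : _ == _ = false) ?scale0r//.
    by apply: contraNF ij => /eqP ij; exact/eqP/val_inj.
  by exists j.+1 => n jn; rewrite !psumE.
Qed.

Let psum_cvg J x : cvg (psum J ^~ x @ \oo).
Proof.
apply: cauchy_cvg; apply: cauchy_exP => eps eps0.
have eps20 : 0 < eps / 2 by rewrite divr_gt0.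
have : closure (linear_span (range e)) x by case: he => _ ->.
move=> /(_ _ (nbhsx_ballx x _ eps20))[y [/(psum_stationary J)[N yN]]].
rewrite -ball_normE/= => xy.
exists (psum J N x); exists N => // n /= Nn.
(* Past [N] the partial sums of [y] cancel, leaving two partial sums of [x - y], each of norm below
   [eps / 2] by Bessel. *)
have -> : psum J N x - psum J n x = psum J N (x - y) - psum J n (x - y).
  by rewrite !psumB (yN n)// opprB addrA subrK.
rewrite (le_lt_trans (ler_normB _ _))// (le_lt_trans (lerD (bessel _ _ _) (bessel _ _ _)))//.
by rewrite [ltRHS]splitr ltrD.
Qed.

Lemma orthogonal_projection_exists J :
  exists P, is_orthogonal_projection (closure (linear_span (e @` J))) P.
Proof.
pose p x := lim (psum J ^~ x @ \oo).
have plin : linear p.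
  move=> a x y; apply: (cvg_lim (@norm_hausdorff _ H)).
  under eq_fun do rewrite psumP.
  by apply: cvgD; [apply: cvgZl_tmp; exact: psum_cvg|exact: psum_cvg].
have p0 : p 0 = 0.
  by have := plin (- 1) 0 0; rewrite scaleN1r addNr scaleN1r addNr.
have pP : p \in @bounded_linear_pred R F H.
  (* The constant 2: some partial sum lies within [|x|] of [p x], and itself has norm at most
     [|x|]. *)
  apply/asboolP; split=> //; exists 2 => x.
  have [->|x0] := eqVneq x 0; first by rewrite p0 !normr0 mulr0.
  have nx0 : 0 < `|x| by rewrite normr_gt0.
  have /cvgrPdist_le/(_ _ nx0)[n _ /(_ n (leqnn n))/= pn] := psum_cvg J x.
  rewrite -(subrK (psum J n x) (p x)) (le_trans (ler_normD _ _))//.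
  by rewrite mulr2n mulrDl mul1r lerD.
exists (Bop pP) => x; split.
  apply: (closed_cvg _ (@closed_closure _ _) _ _ (psum_cvg J x)).
  apply: nearW => n; apply: subset_closure.
  (* Enumerating the indices [i < n] that lie in [J] puts the filtered sum in the form required by
     [linear_span]. *)
  pose A : {pred 'I_n} := fun i => `[< J i >].
  pose i (k : 'I_#|A|) : 'I_n := enum_val k.
  exists #|A|, (fun k => inner x (e (i k))), (fun k => e (i k)).
  split; last by rewrite -[RHS](big_enum_val (fun i : 'I_n => inner x (e i) *: e i)).
  by move=> k; exists (i k) => //; exact/asboolP/(enum_valP k).
(* It suffices to test against [e j] with [j] in [J]; there the residuals are orthogonal once
   [n > j], and this passes to the limit. *)
apply: orthogonal_closure_span => _ [j Jj <-].
apply: (closed_cvg _ (closed_orthogonal_l (e j)) _ _ (cvgB (cvg_cst x) (psum_cvg J x))).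
exists j.+1 => // n /= jn; exact: psum_residual.
Qed.

Lemma basis_projectionP J :
  is_orthogonal_projection (closure (linear_span (e @` J))) (basis_projection e J).
Proof.
rewrite /basis_projection /orthogonal_projection.
(* Existence excludes the default value 0 of [xget]. *)
by case: xgetP => [P -> //|]; have [P hP] := orthogonal_projection_exists J => /(_ P).
Qed.

Lemma basis_projection_in J j : J j -> basis_projection e J (e j) = e j.
Proof.
move=> Jj; have [MP orth] := basis_projectionP J (e j).
(* Both [e j] and its projection lie in the subspace, so their difference is orthogonal to
   itself. *)
apply/esym/eqP; rewrite -subr_eq0; apply/eqP/inner_eq0.
rewrite linearBr/= !orth ?subrr//.
by apply: subset_closure; apply: linear_span_mem; exists j.
Qed.

Lemma basis_projection_notin J j : ~ J j -> basis_projection e J (e j) = 0.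
Proof.
move=> Jj; have [MP orth] := basis_projectionP J (e j).
apply/inner_eq0.
(* The residual is orthogonal to the projection of [e j], and so is [e j] itself; hence the
   projection is orthogonal to itself. *)
have := orth _ MP; rewrite linearBl/= (@orthogonal_closure_span _ _ _ (e j) (e @` J))//.
  by rewrite sub0r => /eqP; rewrite oppr_eq0 => /eqP.
move=> _ [i Ji <-]; rewrite ortho (_ : _ == _ = false)//.
by apply/eqP => ji; apply: Jj; rewrite ji.
Qed.

Lemma basis_projection_idem J :
  basis_projection e J * basis_projection e J = basis_projection e J.
Proof.
apply: bop_eq_basis => j.
rewrite -[LHS]/(basis_projection e J (basis_projection e J (e j))).
have [Jj|Jj] := pselect (J j); first by rewrite !basis_projection_in.
by rewrite !basis_projection_notin// bop0.
Qed.

End orthonormal_system.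

(** * The space of block-scalar diagonal operators *)

Lemma spaceable_of_projections (R : realType) (F : scalarFieldType R)
    (H : hilbertType F) (e : nat -> H) (K : set (bop H)) (J : nat -> set nat) :
  orthonormal_basis e -> two_sided_ideal_cone K ->
  (forall m n, m <> n -> J m `&` J n = set0) -> (forall n, J n !=set0) ->
  (forall n, ~ K (basis_projection e (J n))) ->
  spaceable (~` K).
Proof.
move=> he [Kcone Kideal] Jdisj /choice[p Jp] KP.
have ejN0 j : e j != 0 by rewrite -normr_gt0 norm_basis.
have Jinj m n j : J m j -> J n j -> m = n.
  move=> Jm Jn; apply: contrapT => /Jdisj mn.
  by have : (J m `&` J n) j by []; rewrite mn.
(* For T in L below, this is the scalar by which T acts on the block J n. *)
pose a (T : bop H) n := inner (T (e (p n))) (e (p n)).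
pose L : set (bop H) := [set T : bop H |
  (forall n j, J n j -> T (e j) - a T n *: e j = 0) /\
  (forall j, (forall n, ~ J n j) -> T (e j) = 0)].
have aP c S T n : a (c *: S + T) n = c * a S n + a T n.
  by rewrite /a -[X in inner X _]/(c *: S (e (p n)) + T (e (p n)))
    linearDl linearZl_LR.
have LP n : L (basis_projection e (J n)).
  split=> [m j Jmj|j Jj]; last exact: basis_projection_notin.
  rewrite /a; have [mn|/eqP mn] := eqVneq m n.
    by subst m; rewrite !basis_projection_in// inner_norm norm_basis// expr1n scale1r subrr.
  have nJ i : J m i -> ~ J n i by move=> Jm Jn; exact/mn/(Jinj _ _ i).
  by rewrite !basis_projection_notin ?linear0l ?scale0r ?subrr//; exact: nJ.
exists L; split.
- split=> [|c S T]; rewrite !inE.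
    split=> [n j _|//].
    by rewrite /a [X in X - _](_ : _ = 0)// linear0l scale0r subr0.
  move=> [S1 S2] [T1 T2]; split=> [n j Jj|j Jj].
    rewrite -[X in X - _]/(c *: S (e j) + T (e j)) aP scalerDl opprD addrACA.
    by rewrite T1// addr0 -scalerA -scalerBr S1// scaler0.
  by rewrite -[LHS]/(c *: S (e j) + T (e j)) S2// T2// scaler0 addr0.
- move=> T clT; split=> [n j Jj|j Jj].
    move: clT; rewrite closureEbigcap => /(_ [set T : bop H | T (e j) - a T n *: e j = 0]).
    apply; split; last by move=> S [+ _]; apply.
    (* The constant 2 comes from bounding both [T (e j)] and [a T n] by the operator norm. *)
    apply: (@closed_kernel _ _ _ (fun T : bop H => T (e j) - a T n *: e j) 2) => //.
      move=> S U; rewrite [a _ n]linearBl scalerBl.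
      by rewrite (_ : (S - U : bop H) (e j) = S (e j) - U (e j))// !opprD addrACA.
    move=> S; rewrite (le_trans (ler_normB _ _))// mulr2n mulrDl mul1r.
    have Se i : `|S (e i)| <= `|S|.
      by rewrite (le_trans (ler_opnorm _ _))// norm_basis// mulr1.
    rewrite lerD// normrZ norm_basis// mulr1 (le_trans (cauchy_schwarz _ _))//.
    by rewrite norm_basis// mulr1.
  move: clT; rewrite closureEbigcap => /(_ [set T : bop H | T (e j) = 0]).
  apply; split; last by move=> S [_]; apply.
  apply: (@closed_kernel _ _ _ (fun T : bop H => T (e j)) 1) => // S.
  by rewrite mul1r (le_trans (ler_opnorm _ _))// norm_basis// mulr1.
- apply: (@not_finite_dimensional _ _ _ (fun n => basis_projection e (J n))) => //.
  move=> n c c0 i.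
  (* Evaluated at [e (p i)], the relation keeps only its [i]-th term, since the blocks are
     disjoint. *)
  have /(congr1 (fun T : bop H => T (e (p i)))) := c0.
  rewrite (@big_morph _ _ (fun T : bop H => T (e (p i))) 0 +%R)//.
  rewrite (bigD1 i)//= big1 => [|k ki].
    rewrite addr0 -[X in X = _]/(c i *: basis_projection e (J i) (e (p i))).
    by rewrite basis_projection_in// => /eqP; rewrite scaler_eq0 (negbTE (ejN0 _)) orbF => /eqP.
  rewrite -[LHS]/(c k *: basis_projection e (J k) (e (p i))).
  rewrite basis_projection_notin ?scaler0// => Jki.
  by case/negP: ki; apply/eqP/val_inj/(Jinj _ _ (p i)).
- move=> T [T1 T2]; rewrite /setU/=.
  have [[n an]|/forallNP aT0] := pselect (exists n, a T n <> 0); [left|right].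
    move=> KT; apply: (KP n).
    (* The identity is checked on [e j] for [j] in [J n], in another block, or in no block. *)
    have -> : basis_projection e (J n) =
        (a T n)^-1 *: (basis_projection e (J n) * T).
      apply: (bop_eq_basis e he) => j.
      rewrite -[RHS]/((a T n)^-1 *: basis_projection e (J n) (T (e j))).
      have [Jj|Jj] := pselect (J n j).
        have /eqP := T1 n j Jj; rewrite subr_eq0 => /eqP ->.
        by rewrite bopZ scalerA mulVf ?scale1r//; exact/eqP.
      have [[m Jm]|/forallNP Jjm] := pselect (exists m, J m j).
        have /eqP := T1 m j Jm; rewrite subr_eq0 => /eqP ->.
        by rewrite bopZ basis_projection_notin// !scaler0.
      by rewrite T2// bop0 scaler0 basis_projection_notin.
    by apply: Kcone; have [] := Kideal T (basis_projection e (J n)) KT.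
  apply: (bop_eq_basis e he) => j.
  have [[n Jn]|/forallNP Jj] := pselect (exists n, J n j); last exact: T2.
  have /eqP := T1 n j Jn; rewrite (contrapT (aT0 n)) scale0r subr0.
  by move/eqP.
Qed.

Theorem corollary4p9 (R : realType) (F : scalarFieldType R) (H : hilbertType F)
    (e : nat -> H) (he : orthonormal_basis e)
    (K : set (bop H)) (hK : two_sided_ideal_cone K)
    (hJ : exists J : nat -> set nat,
       (forall m n : nat, m <> n -> J m `&` J n = set0) /\
       (forall n : nat, compression e (J n) K <> compression e (J n) setT)) :
  spaceable (~` K).
Proof.
have [K0|/set0P[T0 KT0]] := eqVneq K set0.
  apply: (@spaceable_of_projections _ _ _ e _ (fun n => [set n])) => //.
  - by move=> m n mn; rewrite -subset0 => j [/= -> nm]; exact: mn.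
  - by move=> n; exists n.
  - by move=> n; rewrite K0.
have [J [Jdisj Jne]] := hJ; have [Kcone Kideal] := hK.
have KP n : ~ K (basis_projection e (J n)).
  move=> KP; apply: (Jne n); rewrite eqEsubset; split=> _ [T _ <-]; first by exists T.
  set P := basis_projection e (J n) in KP *.
  exists (P * T); first by have [] := Kideal _ T KP.
  by rewrite mulrA (basis_projection_idem e he).
apply: (@spaceable_of_projections _ _ _ e _ J) => // n.
(* An empty [J n] would make the projection [0 *: T0], which lies in the cone [K]. *)
apply/set0P/eqP => Jn0; apply: (KP n).
suff -> : basis_projection e (J n) = 0 *: T0 by exact: Kcone.
apply: (bop_eq_basis e he) => j; rewrite basis_projection_notin// ?Jn0//.
by rewrite scale0r.
Qed.
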